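(* Let $R$ be a conditional bisimulation for a conditional reactive system $\mathcal S$. Then the binary relation $R'=\{(a;d,\ b;d)\mid (a,b,\mathcal C)\in R,\ d\models\mathcal C\}$ is a bisimulation for the reaction relation $\leadsto$, i.e. whenever $(x,y)\in R'$ and $x\leadsto x'$, there is $y'$ with $y\leadsto y'$ and $(x',y')\in R'$, and whenever $(x,y)\in R'$ and $y\leadsto y'$, there is $x'$ with $x\leadsto x'$ and $(x',y')\in R'$.
   Context: Composition of $f\colon A\to B$, $g\colon B\to C$ is written $f;g$. Fix a category $\mathbf C$ with distinguished object $0$ and a representative class $\kappa$ of commuting squares: for every commuting square $\alpha_1;\delta_1=\alpha_2;\delta_2$ there are $(\alpha_1,\alpha_2,\beta_1,\beta_2)\in\kappa$ (a commuting square) and $\gamma$ with $\delta_1=\beta_1;\gamma$, $\delta_2=\beta_2;\gamma$; $\kappa(\alpha_1,\alpha_2)$ is the set of $(\beta_1,\beta_2)$ with $(\alpha_1,\alpha_2,\beta_1,\beta_2)\in\kappa$. Conditions over $A$ are defined inductively as $(A,\mathcal Q,S)$, $\mathcal Q\in\{\forall,\exists\}$, $S$ a finite set of pairs $(h,\mathcal A')$ with $h\colon A\to A'$, $\mathcal A'$ a condition over $A'$. For $a\colon A\to B$: $a\models(A,\forall,S)$ iff for all $(h,\mathcal A')\in S$ and all $g$ with $a=h;g$, $g\models\mathcal A'$; $a\models(A,\exists,S)$ iff some $(h,\mathcal A')\in S$ and $g$ satisfy $a=h;g$, $g\models\mathcal A'$. $\mathcal A\models\mathcal B$: every arrow satisfying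 $\mathcal A$ satisfies $\mathcal B$. Boolean connectives $\neg,\land,\lor$ on conditions over the same root have the standard semantics. Shift along $c\colon A\to B$: $(A,\mathcal Q,S)_{\downarrow c}=(B,\mathcal Q,\{(\beta,\mathcal A'_{\downarrow\alpha})\mid(h,\mathcal A')\in S,(\alpha,\beta)\in\kappa(h,c)\})$; it satisfies $c;d\models\mathcal A\iff d\models\mathcal A_{\downarrow c}$. A conditional reactive system is a set $\mathcal S$ of rules $(\ell,r,\mathcal R)$, $\ell,r\colon0\to I$, $\mathcal R$ a condition over $I$. Reaction: $a\leadsto a'$ iff there are a rule and $c$ with $a=\ell;c$, $a'=r;c$, $c\models\mathcal R$. Context step $a\xrightarrow[C]{f,\ \mathcal A}a'$ ($a\colon0\to J$, $f\colon J\to K$, $a'\colon0\to K$, $\mathcal A$ over $K$): there are a rule $(\ell,r,\mathcal R)$ and $c\colon I\to K$ with $a;f=\ell;c$, $a'=r;c$, $\mathcal A\models\mathcal R_{\downarrow c}$. A conditional relation is a set of triples $(a,b,\mathcal C)$ with $a,b\colon0\to J$ and $\mathcal C$ a condition over $J$. For a possibly infinite family, $\mathcal D\models\bigvee_{i\in I}\mathcal E_i$ means every arrow satisfying $\mathcal D$ satisfies some $\mathcal E_i$. A conditional bisimulation is a conditional relation $R$ such that for each $(a,b,\mathcal C)\in R$ and each context step $a\xrightarrow[C]{f,\ \mathcal A}a'$ there are a (possibly infinite) index set $I$, context steps $b\xrightarrow[C]{f,\ \mathcal B_i}b'_i$ and conditions $\mathcal C'_i$ with $(a',b'_i,\mathcal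 C'_i)\in R$ for all $i$ and $\mathcal A\land\mathcal C_{\downarrow f}\models\bigvee_{i\in I}(\mathcal C'_i\land\mathcal B_i)$; and symmetrically every context step $b\xrightarrow[C]{f,\ \mathcal B}b'$ is answered by context steps $a\xrightarrow[C]{f,\ \mathcal A_j}a'_j$ with $(a'_j,b',\mathcal C'_j)\in R$ and $\mathcal B\land\mathcal C_{\downarrow f}\models\bigvee_j(\mathcal C'_j\land\mathcal A_j)$. *)

(* Defs.v *)
From Stdlib Require Import List.

Set Implicit Arguments.
Unset Strict Implicit.
Unset Printing Implicit Defensive.

Record category := Category {
  obj :> Type;
  hom : obj -> obj -> Type;
  idm : forall A, hom A A;
  comp : forall A B D, hom A B -> hom B D -> hom A D;
  comp_idl : forall A B (f : hom A B), comp (idm A) f = f;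
  comp_idr : forall A B (f : hom A B), comp f (idm B) = f;
  comp_assoc : forall A B D E (f : hom A B) (g : hom B D) (h : hom D E),
    comp f (comp g h) = comp (comp f g) h
}.

Arguments hom {c} _ _.
Arguments idm {c} A.
Arguments comp {c A B D} f g.

(* Diagrammatic order: [f ;; g] is first [f], then [g]. *)
Notation "f ;; g" := (comp f g) (at level 45, left associativity).

(* [rsq a1 a2 b1 b2] : the square a1 ;; b1 = a2 ;; b2 belongs to the class.
   [kappa a1 a2] enumerates the squares of the class over the span (a1, a2);
   this set must be finite for the shift of a (finitely branching) condition
   to be a condition again. *)
Record rep_class (C : category) := RepClass {
  rsq : forall A B1 B2 D : C,
    hom A B1 -> hom A B2 -> hom B1 D -> hom B2 D -> Prop;
  rsq_comm : forall (A B1 B2 D : C) (a1 : hom A B1) (a2 : hom A B2)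
      (b1 : hom B1 D) (b2 : hom B2 D),
    rsq a1 a2 b1 b2 -> a1 ;; b1 = a2 ;; b2;
  rsq_repr : forall (A B1 B2 D : C) (a1 : hom A B1) (a2 : hom A B2)
      (d1 : hom B1 D) (d2 : hom B2 D),
    a1 ;; d1 = a2 ;; d2 ->
    exists (E : C) (b1 : hom B1 E) (b2 : hom B2 E) (g : hom E D),
      rsq a1 a2 b1 b2 /\ d1 = b1 ;; g /\ d2 = b2 ;; g;
  kappa : forall A B1 B2 : C, hom A B1 -> hom A B2 ->
    list {D : C & (hom B1 D * hom B2 D)%type};
  kappaP : forall (A B1 B2 D : C) (a1 : hom A B1) (a2 : hom A B2)
      (b1 : hom B1 D) (b2 : hom B2 D),
    In (existT _ D (b1, b2)) (kappa a1 a2) <-> rsq a1 a2 b1 b2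
}.

Inductive quant := QAll | QEx.

(* [cond A]: conditions with root A; finite sets of children are lists. *)
Inductive cond (C : category) (A : C) : Type :=
  Cond (q : quant) (br : list {A' : C & (hom A A' * cond A')%type}).

Arguments Cond {C A} q br.

(* The folds are needed for structural recursion; see [sat_all], [sat_ex]. *)
Fixpoint sat (C : category) (A : C) (K : cond A) (B : C) (a : hom A B)
    {struct K} : Prop :=
  match K with
  | Cond QAll br =>
      fold_right (fun p P => match p with
        | existT _ A' (h, K') =>
            (forall g : hom A' B, a = h ;; g -> sat K' g) /\ P
        end) True br
  | Cond QEx br =>
      fold_right (fun p P => match p with
        | existT _ A' (h, K') =>
            (exists g : hom A' B, a = h ;; g /\ sat K' g) \/ P
        end) False br
  end.

Lemma sat_all (C : category) (A : C)
    (br : list {A' : C & (hom A A' * cond A')%type}) (B : C) (a : hom A B) :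
  sat (Cond QAll br) a <->
  forall (A' : C) (h : hom A A') (K' : cond A'),
    In (existT _ A' (h, K')) br ->
    forall g : hom A' B, a = h ;; g -> sat K' g.
Proof.
induction br as [|[A1 [h1 K1]] br IH].
- split; [intros _ A' h K' [] | intros _; exact I].
- split.
  + intros [H1 HS] A' h K' [E|HI].
    * assert (X : forall p : {A' : C & (hom A A' * cond A')%type},
          existT _ A1 (h1, K1) = p ->
          match p with existT _ A' (h, K') =>
            forall g : hom A' B, a = h ;; g -> sat K' g end)
        by (intros p Ep; subst p; exact H1).
      exact (X _ E).
    * exact (proj1 IH HS A' h K' HI).
  + intros H; split.
    * exact (H A1 h1 K1 (or_introl eq_refl)).
    * apply IH; intros A' h K' HI; exact (H A' h K' (or_intror HI)).
Qed.

Lemma sat_ex (C : category) (A : C)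
    (br : list {A' : C & (hom A A' * cond A')%type}) (B : C) (a : hom A B) :
  sat (Cond QEx br) a <->
  exists (A' : C) (h : hom A A') (K' : cond A') (g : hom A' B),
    In (existT _ A' (h, K')) br /\ a = h ;; g /\ sat K' g.
Proof.
induction br as [|[A1 [h1 K1]] br IH].
- split; [intros [] | intros (A' & h & K' & g & [] & _)].
- split.
  + intros [[g [E Hg]]|HS].
    * exists A1, h1, K1, g; split; [left; reflexivity | split; assumption].
    * destruct (proj1 IH HS) as (A' & h & K' & g & HI & H).
      exists A', h, K', g; split; [right; exact HI | exact H].
  + intros (A' & h & K' & g & [E|HI] & H).
    * assert (X : forall p : {A' : C & (hom A A' * cond A')%type},
          existT _ A1 (h1, K1) = p ->
          match p with existT _ A' (h, K') =>
            (exists g : hom A' B, a = h ;; g /\ sat K' g) ->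
            sat (Cond QEx (existT _ A1 (h1, K1) :: br)) a end)
        by (intros p Ep; subst p; intros Hp; left; exact Hp).
      apply (X _ E); exists g; exact H.
    * right; apply IH; exists A', h, K', g; split; assumption.
Qed.

Fixpoint shift (C : category) (kap : rep_class C) (A : C) (K : cond A)
    (B : C) (c : hom A B) {struct K} : cond B :=
  match K with
  | Cond q br =>
      Cond q (flat_map (fun p => match p with
        | existT _ A' (h, K') =>
            map (fun s => match s with
              | existT _ D (alpha, beta) =>
                  existT (fun D : C => (hom B D * cond D)%type) D
                         (beta, shift kap K' alpha)
              end) (kappa kap h c)
        end) br)
  end.

(* Conjunction, encoded with identity arrows. *)
Definition cand (C : category) (A : C) (K L : cond A) : cond A :=
  Cond QAll (existT _ A (idm A, K) :: existT _ A (idm A, L) :: nil).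

Lemma sat_cand (C : category) (A : C) (K L : cond A) (B : C) (a : hom A B) :
  sat (cand K L) a <-> sat K a /\ sat L a.
Proof.
assert (X : forall M : cond A,
    (forall g, a = idm A ;; g -> sat M g) <-> sat M a).
{ intros M; split.
  - intros H; apply H; symmetry; apply comp_idl.
  - intros H g E; rewrite comp_idl in E; rewrite <- E; exact H. }
simpl; rewrite !X; tauto.
Qed.

Definition entails (C : category) (A : C) (K L : cond A) : Prop :=
  forall (B : C) (a : hom A B), sat K a -> sat L a.

Definition entails_disj (C : category) (A : C) (K : cond A)
    (I : Type) (L : I -> cond A) : Prop :=
  forall (B : C) (a : hom A B), sat K a -> exists i : I, sat (L i) a.

Record rule (C : category) (Z : C) := Rule {
  interface : C;
  lhs : hom Z interface;
  rhs : hom Z interface;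
  app_cond : cond interface
}.

Definition reactive_system (C : category) (Z : C) := rule Z -> Prop.

Definition reaction (C : category) (Z : C) (Sys : reactive_system Z)
    (J : C) (a a' : hom Z J) : Prop :=
  exists (rho : rule Z) (c : hom (interface rho) J),
    Sys rho /\ a = lhs rho ;; c /\ a' = rhs rho ;; c /\ sat (app_cond rho) c.

Definition context_step (C : category) (kap : rep_class C) (Z : C)
    (Sys : reactive_system Z) (J K : C)
    (a : hom Z J) (f : hom J K) (cA : cond K) (a' : hom Z K) : Prop :=
  exists (rho : rule Z) (c : hom (interface rho) K),
    Sys rho /\ a ;; f = lhs rho ;; c /\ a' = rhs rho ;; c /\
    entails cA (shift kap (app_cond rho) c).

Definition cond_relation (C : category) (Z : C) :=
  forall J : C, hom Z J -> hom Z J -> cond J -> Prop.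

Definition cond_bisimulation (C : category) (kap : rep_class C) (Z : C)
    (Sys : reactive_system Z) (R : cond_relation Z) : Prop :=
  forall (J : C) (a b : hom Z J) (cC : cond J), R J a b cC ->
    (forall (K : C) (f : hom J K) (cA : cond K) (a' : hom Z K),
       context_step kap Sys a f cA a' ->
       exists (I : Type) (cB : I -> cond K) (b' : I -> hom Z K)
              (cC' : I -> cond K),
         (forall i, context_step kap Sys b f (cB i) (b' i)) /\
         (forall i, R K a' (b' i) (cC' i)) /\
         entails_disj (cand cA (shift kap cC f))
                      (fun i => cand (cC' i) (cB i))) /\
    (forall (K : C) (f : hom J K) (cB : cond K) (b' : hom Z K),
       context_step kap Sys b f cB b' ->
       exists (I : Type) (cA : I -> cond K) (a' : I -> hom Z K)
              (cC' : I -> cond K),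
         (forall j, context_step kap Sys a f (cA j) (a' j)) /\
         (forall j, R K (a' j) b' (cC' j)) /\
         entails_disj (cand cB (shift kap cC f))
                      (fun j => cand (cC' j) (cA j))).

Definition arrow_relation (C : category) (Z : C) :=
  forall K : C, hom Z K -> hom Z K -> Prop.

Definition context_closure (C : category) (Z : C) (R : cond_relation Z) :
    arrow_relation Z :=
  fun (K : C) (x y : hom Z K) =>
    exists (J : C) (a b : hom Z J) (cC : cond J) (d : hom J K),
      R J a b cC /\ sat cC d /\ x = a ;; d /\ y = b ;; d.

Definition reaction_bisimulation (C : category) (Z : C)
    (Sys : reactive_system Z) (T : arrow_relation Z) : Prop :=
  forall (K : C) (x y : hom Z K), T K x y ->
    (forall x', reaction Sys x x' -> exists y', reaction Sys y y' /\ T K x' y') /\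
    (forall y', reaction Sys y y' -> exists x', reaction Sys x x' /\ T K x' y').

(* Main.v *)
(* Given a reaction of a;d, the arrow d itself serves as the label of a context
   step of a, with condition the shifted application condition.  The identity
   satisfies both this condition and the shift of C along d, so it satisfies
   one of the alternatives offered by the conditional bisimulation; that
   alternative, read at the identity, is the answering reaction of b;d. *)
From Stdlib Require Import List.
Require Import Defs.

(* The generated principle gives no hypothesis for the nested children. *)
Lemma cond_nested_ind (C : category) (P : forall A : C, cond A -> Prop)
    (HP : forall (A : C) q (br : list {A' : C & (hom A A' * cond A')%type}),
      (forall (A' : C) (h : hom A A') (K' : cond A'),
        In (existT _ A' (h, K')) br -> P A' K') ->
      P A (Cond q br)) :
  forall (A : C) (K : cond A), P A K.
Proof.
fix IH 2; intros A [q br]; apply HP.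
assert (H : Forall (fun p => P (projT1 p) (snd (projT2 p))) br).
{ induction br as [|[A1 [h1 K1]] br IHbr]; constructor.
  - exact (IH A1 K1).
  - exact IHbr. }
intros A' h K' HI.
exact (proj1 (Forall_forall _ _) H _ HI).
Qed.

(** Names the list of children that [shift] computes by projecting it out of a shifted condition.
    The choice of [QAll] is arbitrary, because [shift] copies the quantifier and builds the same
    children for both. *)
Definition shift_branches {C : category} (kap : rep_class C) {A B : C}
    (c : hom A B) (br : list {A' : C & (hom A A' * cond A')%type}) :
    list {D : C & (hom B D * cond D)%type} :=
  match shift kap (Cond QAll br) c with Cond _ br' => br' end.

Lemma shift_Cond (C : category) (kap : rep_class C) (A B : C) (c : hom A B)
    q (br : list {A' : C & (hom A A' * cond A')%type}) :
  shift kap (Cond q br) c = Cond q (shift_branches kap c br).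
Proof. reflexivity. Qed.

Lemma in_shift_branches (C : category) (kap : rep_class C) (A B : C)
    (c : hom A B) (br : list {A' : C & (hom A A' * cond A')%type})
    (D : C) (beta : hom B D) (L : cond D) :
  In (existT _ D (beta, L)) (shift_branches kap c br) <->
  exists (A' : C) (h : hom A A') (K' : cond A') (alpha : hom A' D),
    In (existT _ A' (h, K')) br /\ rsq kap h c alpha beta /\
    L = shift kap K' alpha.
Proof.
unfold shift_branches; simpl; rewrite in_flat_map; split.
- intros ([A' [h K']] & HI & Hm).
  apply in_map_iff in Hm; destruct Hm as ([E [al be]] & e & Hk).
  (* The equality of dependent pairs splits into an equality of objects, which [subst] eliminates,
     and an equality of ordinary pairs. *)
  inversion_sigma e; subst; simpl in *.
  match goal with H : (_, _) = (_, _) |- _ => injection H; intros; subst end.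
  exists A', h, K', al; split; [exact HI|]; split; [|reflexivity].
  apply kappaP; exact Hk.
- intros (A' & h & K' & al & HI & Hs & ->).
  exists (existT _ A' (h, K')); split; [exact HI|].
  apply in_map_iff; exists (existT _ D (al, beta)); split; [reflexivity|].
  apply kappaP; exact Hs.
Qed.

(** A factorisation of [c ;; d] through a child arrow [h] is a commuting square over [h] and [c],
    hence factors through a representative square; conversely, representative squares commute.
    Induction handles the children. *)
Lemma sat_shift {C : category} (kap : rep_class C) {A : C} (K : cond A)
    (B : C) (c : hom A B) (D : C) (d : hom B D) :
  sat (shift kap K c) d <-> sat K (c ;; d).
Proof.
revert B c D d; pattern A, K; apply cond_nested_ind; clear A K.
intros A [] br IH B c D d; rewrite shift_Cond.
- rewrite !sat_all; split.
  + intros H A' h K' HI g e.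
    (* Now [g] is [al ;; k] and [d] is [be ;; k], so the shifted child is tested at [k]. *)
    destruct (rsq_repr kap (eq_sym e)) as (E & al & be & k & Hs & -> & ->).
    apply (IH A' h K' HI).
    apply (H E be (shift kap K' al)); [|reflexivity].
    apply in_shift_branches; exists A', h, K', al; auto.
  + intros H E be L HI g ->.
    apply in_shift_branches in HI.
    destruct HI as (A' & h & K' & al & HI & Hs & ->).
    apply (IH A' h K' HI), (H A' h K' HI).
    rewrite !comp_assoc; rewrite (rsq_comm Hs); reflexivity.
- rewrite !sat_ex; split.
  + intros (E & be & L & g & HI & -> & Hg).
    apply in_shift_branches in HI.
    destruct HI as (A' & h & K' & al & HI & Hs & ->).
    exists A', h, K', (al ;; g); split; [exact HI|]; split.
    * rewrite !comp_assoc; rewrite (rsq_comm Hs); reflexivity.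
    * apply (IH A' h K' HI); exact Hg.
  + intros (A' & h & K' & g & HI & e & Hg).
    destruct (rsq_repr kap (eq_sym e)) as (E & al & be & k & Hs & -> & ->).
    exists E, be, (shift kap K' al), k; split; [|split; [reflexivity|]].
    * apply in_shift_branches; exists A', h, K', al; auto.
    * apply (IH A' h K' HI); exact Hg.
Qed.

Lemma sat_shift_id {C : category} (kap : rep_class C) {A : C} (K : cond A)
    (B : C) (c : hom A B) :
  sat (shift kap K c) (idm B) <-> sat K c.
Proof. rewrite sat_shift, comp_idr; reflexivity. Qed.

(** Forwards, the shifted application condition itself serves as [cA], so the entailment is trivial;
    backwards, the entailment is evaluated at the identity. *)
Lemma reaction_context_step {C : category} (kap : rep_class C) {Z : C}
    (Sys : reactive_system Z) {J K : C} (a : hom Z J) (f : hom J K)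
    (a' : hom Z K) :
  reaction Sys (a ;; f) a' <->
  exists cA : cond K, context_step kap Sys a f cA a' /\ sat cA (idm K).
Proof.
split.
- intros (rho & c & Hrho & e & e' & Hc).
  exists (shift kap (app_cond rho) c); split.
  + exists rho, c; repeat split; try assumption; intros D g H; exact H.
  + apply sat_shift_id; exact Hc.
- intros (cA & (rho & c & Hrho & e & e' & HA) & Hid).
  exists rho, c; repeat split; try assumption.
  apply (sat_shift_id kap), HA, Hid.
Qed.

Lemma context_closure_id {C : category} {Z : C} {R : cond_relation Z}
    {K : C} {x y : hom Z K} {cC : cond K} :
  R K x y cC -> sat cC (idm K) -> context_closure R x y.
Proof.
intros HR Hid; exists K, x, y, cC, (idm K).
rewrite !comp_idr; auto.
Qed.

Theorem theorem4p9 (C : category) (kap : rep_class C) (Z : C)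
    (Sys : reactive_system Z) (R : cond_relation Z)
    (hR : cond_bisimulation kap Sys R) :
  reaction_bisimulation Sys (context_closure R).
Proof.
intros K x y (J & a & b & cC & d & HR & Hd & -> & ->).
destruct (hR _ _ _ _ HR) as [Hab Hba].
apply (sat_shift_id kap) in Hd.
split.
- intros x' Hx; apply (reaction_context_step kap) in Hx.
  destruct Hx as (cA & Hstep & HA).
  destruct (Hab _ _ _ _ Hstep) as (I & cB & b' & cC' & Hb & HR' & Hent).
  (* Evaluating at this single arrow yields one index [i], even if [I] is infinite. *)
  destruct (Hent _ (idm K)) as [i Hi]; [apply sat_cand; auto|].
  apply sat_cand in Hi; destruct Hi as [HC HB].
  exists (b' i); split.
  + apply (reaction_context_step kap); exists (cB i); auto.
  + exact (context_closure_id (HR' i) HC).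
- intros y' Hy; apply (reaction_context_step kap) in Hy.
  destruct Hy as (cB & Hstep & HB).
  destruct (Hba _ _ _ _ Hstep) as (I & cA & a' & cC' & Ha & HR' & Hent).
  destruct (Hent _ (idm K)) as [i Hi]; [apply sat_cand; auto|].
  apply sat_cand in Hi; destruct Hi as [HC HA].
  exists (a' i); split.
  + apply (reaction_context_step kap); exists (cA i); auto.
  + exact (context_closure_id (HR' i) HC).
Qed.
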